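(* Let $i \geq 3$ be an integer and let $n = F_{i+1} + F_{i-2}$, where $(F_k)$ denotes the Fibonacci numbers indexed by $F_1 = 1$, $F_2 = 2$, $F_{k+1} = F_k + F_{k-1}$. Then Player 1 has a winning strategy for the reversed Zeckendorf game on $n$.
   Context: Fibonacci numbers are indexed $F_1=1$, $F_2=2$, $F_{k+1}=F_k+F_{k-1}$. A game state is a multiset of Fibonacci numbers (''chips'') summing to $n$; the number of chips equal to $F_k$ is the height $h_k$ of bin $k$. The reversed Zeckendorf game on $n$ is a two-player game starting at the Zeckendorf decomposition of $n$ (the unique representation of $n$ as a sum of distinct, pairwise non-consecutive Fibonacci numbers $F_k$), one chip for each term. Players alternate moves; the legal moves are: (Split) for $k \geq 3$, if $h_k \geq 1$, replace one chip $F_k$ by one chip $F_{k-1}$ and one chip $F_{k-2}$; and if $h_2 \geq 1$, replace one chip $F_2$ by two chips $F_1$. (Combine) for $k > 2$, if $h_{k-2}\ge 1$ and $h_{k+1} \geq 1$, replace one chip $F_{k-2}$ and one chip $F_{k+1}$ by two chips $F_k$; and if $h_1 \geq 1$ and $h_3 \geq 1$, replace one chip $F_1$ and one chip $F_3$ by two chips $F_2$. A player who cannot move (which happens exactly when all chips equal $F_1$) loses. ''Winning strategy'' means a forced win regardless of the opponent's play. *)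

(* Defs.v *)
From mathcomp Require Import all_boot finmap multiset zify.

Set Implicit Arguments.
Unset Strict Implicit.
Unset Printing Implicit Defensive.

Local Open Scope nat_scope.
Local Open Scope mset_scope.

(* Indexed so that F_1 = 1 and F_2 = 2; the value F_0 = 1 only serves to start
   the recurrence, and no chip is ever placed in bin 0. *)
Fixpoint F (k : nat) : nat :=
  match k with
  | 0 => 1
  | 1 => 1
  | (k''.+1 as k').+1 => F k' + F k''
  end.

(* A chip is represented by the index k of its bin and has value F k, so that
   s k is the height of bin k in the state s. *)
Notation state := {mset nat}.

Definition value (s : state) : nat := \sum_(k <- s) F k.

Inductive move (s : state) : state -> Prop :=
| Split k of 3 <= k & 1 <= s k :
    move s ((s `\` [mset k]) `+` [mset k - 1; k - 2])
| Split2 of 1 <= s 2 :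
    move s ((s `\` [mset 2]) `+` [mset 1; 1])
| Combine k of 2 < k & 1 <= s (k - 2) & 1 <= s (k + 1) :
    move s ((s `\` [mset k - 2; k + 1]) `+` [mset k; k])
| Combine2 of 1 <= s 1 & 1 <= s 3 :
    move s ((s `\` [mset 1; 3]) `+` [mset 2; 2]).

(* The player to move at s can force a win: some move leads to a state s' at
   which every reply of the opponent (possibly none, in which case the opponent
   has lost) leads back to a state where the player to move can force a win.
   Being inductive, this only accepts wins reached after finitely many moves. *)
Inductive forced_win (s : state) : Prop :=
  ForcedWin s' of move s s' & (forall s'', move s' s'' -> forced_win s'').

Definition is_zeckendorf (n : nat) (s : state) : Prop :=
  [/\ s 0 = 0,
      forall k, s k <= 1,
      forall k, 1 <= s k -> s k.+1 = 0
    & value s = n].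

Lemma F_gt0 k : 0 < F k.
Proof.
suff: (0 < F k) && (0 < F k.+1) by case/andP.
by elim: k => //= k /andP[h1 h2]; rewrite h2 addn_gt0 h2.
Qed.

Lemma FSS k : F k.+2 = F k.+1 + F k.
Proof. by []. Qed.

Lemma value_mset0 : value mset0 = 0.
Proof. by rewrite /value big_mset0. Qed.

Lemma valueD1 k (s : state) : value (k +` s) = F k + value s.
Proof.
rewrite /value.
have p : perm_eq (k +` s) (k :: s).
  apply/allP => x _ /=; rewrite !count_mem_mset mset1DE; apply/eqP.
  by rewrite eq_sym.
by rewrite (perm_big _ p) big_cons.
Qed.

Lemma is_zeckendorf_rem n (s : state) k :
  is_zeckendorf n s -> 1 <= s k -> is_zeckendorf (n - F k) (s `\ k).
Proof.
case=> s0 s1 sc sn sk; have eqs : k +` (s `\ k) = s.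
  by apply: msetB1K; rewrite in_mset.
split.
- by rewrite msetB1E s0.
- by move=> j; rewrite msetB1E; apply: leq_trans (leq_subr _ _) (s1 j).
- move=> j; rewrite !msetB1E => h; rewrite sc //.
  exact: leq_trans h (leq_subr _ _).
- by rewrite -sn -{2}eqs valueD1 addKn.
Qed.

Lemma is_zeckendorf_add n (s : state) k : 1 <= k ->
  s k.-1 = 0 -> s k = 0 -> s k.+1 = 0 ->
  is_zeckendorf n s -> is_zeckendorf (F k + n) (k +` s).
Proof.
move=> k0 sp sk sS [s0 s1 sc sn]; split.
- by rewrite mset1DE s0; case: k k0 {sp sk sS}.
- by move=> j; rewrite mset1DE; case: eqP => [->|_]; rewrite ?sk // s1.
- move=> j; rewrite !mset1DE; case: eqP => [-> _|_].
    by rewrite sS; lia.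
  rewrite add0n => sj; rewrite (sc _ sj).
  by case: eqP => // jk; move: sj; rewrite (_ : j = k.-1) ?sp //; lia.
- by rewrite valueD1 sn.
Qed.

Definition bounded m (s : state) := forall k, m < k -> s k = 0.

Lemma bounded_rem m (s : state) k : bounded m.+1 s ->
  (forall k, s k <= 1) -> k = m.+1 -> bounded m (s `\ k).
Proof.
move=> bs s1 -> j mj; rewrite msetB1E; case: eqP => [->|jm].
  by have := s1 m.+1; lia.
by rewrite bs //; lia.
Qed.

Lemma zeckendorf_lt m n s : is_zeckendorf n s -> bounded m s -> n < F m.+1.
Proof.
suff H : forall m, (forall n s, is_zeckendorf n s -> bounded m s -> n < F m.+1)
     /\ (forall n s, is_zeckendorf n s -> bounded m.+1 s -> n < F m.+2).
  by have [+ _] := H m; apply.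
have B0 n0 s0 : is_zeckendorf n0 s0 -> bounded 0 s0 -> n0 < F 1.
  case=> z0 _ _ <- b0; suff -> : s0 = mset0 by rewrite value_mset0.
  by apply/msetP => -[|j]; rewrite mset0E // b0.
have step m0 : (forall n s, is_zeckendorf n s -> bounded m0 s -> n < F m0.+1) ->
    (forall n s, is_zeckendorf n s -> bounded m0.-1 s -> n < F m0.-1.+1) ->
    forall n s, is_zeckendorf n s -> bounded m0.+1 s -> n < F m0.+2.
  move=> H1 H0 n1 s1 z1 b1; case: (posnP (s1 m0.+1)) => sm.
    have : n1 < F m0.+1.
      apply: H1 z1 _ => j; rewrite leq_eqVlt => /orP[/eqP <- //|]; exact: b1.
    by rewrite FSS; lia.
  have zr := is_zeckendorf_rem z1 sm.
  have [z10 z11 z1c _] := z1.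
  have br : bounded m0.-1 (s1 `\ m0.+1).
    have b' := bounded_rem b1 z11 erefl.
    move=> j hj; case: (ltngtP m0 j) => [/b' //|jm|jm]; first by lia.
    rewrite -jm msetB1E; case: (posnP (s1 m0)) => [-> //|p].
    by have := z1c _ p; lia.
  have := H0 _ _ zr br.
  have : F m0.-1.+1 <= F m0 by case: (m0).
  by rewrite FSS; lia.
elim=> [|m0 [IH0 IH1]]; first by split=> //; apply: step.
by split=> //; apply: step.
Qed.

Lemma zeckendorf_exists n : exists s, is_zeckendorf n s.
Proof.
suff H : forall m, forall n, n < F m.+1 ->
    exists s, is_zeckendorf n s /\ bounded m s.
  have nF : n < F n.+1.
    elim: n => // n IH; rewrite FSS.
    by have := F_gt0 n; lia.
  by have [s [zs _]] := H _ _ nF; exists s.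
elim/ltn_ind => -[_ n1|m IH n1 hn].
  move=> n1_lt1; have -> : n1 = 0 by move: n1_lt1 => /=; lia.
  exists mset0; split; last by move=> k; rewrite mset0E.
  by split=> [|k|k|]; rewrite ?mset0E ?value_mset0.
case: (ltnP n1 (F m.+1)) => h.
  have [s [zs bs]] := IH m (leqnn _) _ h.
  by exists s; split=> // k hk; apply: bs; lia.
have hm : n1 - F m.+1 < F m.-1.+1.
  by case: m {IH} hn h => [|m]; rewrite FSS /= => *; lia.
have [s [zs bs]] := IH m.-1 ltac:(lia) _ hm.
exists (m.+1 +` s); split.
  rewrite -(subnKC h); apply: is_zeckendorf_add => //=.
  - case: m {IH hn h hm} bs zs => [_ []//|m bs _]; exact: bs.
  - by apply: bs; lia.
  - by apply: bs; lia.
move=> k hk; rewrite mset1DE bs ?addn0; last by lia.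
by case: eqP => //; lia.
Qed.

Lemma zeckendorf_unique n s t :
  is_zeckendorf n s -> is_zeckendorf n t -> s = t.
Proof.
have ub (u : state) : exists m, bounded m u.
  exists (\max_(k <- u) k) => k hk; apply/mset_eq0P/negP => ku.
  by have := @leq_bigmax_seq _ _ xpredT id _ ku isT; rewrite /= leqNgt hk.
have [a ba] := ub s; have [b bb] := ub t.
have {a ba b bb} [m [bs bt]] : exists m, bounded m s /\ bounded m t.
  by exists (a + b); split=> k hk; [apply: ba | apply: bb]; lia.
elim: m n s t bs bt => [|m IH] n s t bs bt zs zt.
  have [s0 _ _ _] := zs; have [t0 _ _ _] := zt.
  by apply/msetP => -[|k]; rewrite ?s0 ?t0 // bs ?bt.
have low (u : state) : bounded m.+1 u -> u m.+1 = 0 -> bounded m u.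
  by move=> bu um j; rewrite leq_eqVlt => /orP[/eqP <- //|]; exact: bu.
have big (u : state) : is_zeckendorf n u -> 0 < u m.+1 -> F m.+1 <= n.
  move=> [_ _ _ <-] um; rewrite -(@msetB1K _ m.+1 u) ?in_mset // valueD1.
  exact: leq_addr.
have [_ s1 _ _] := zs; have [_ t1 _ _] := zt.
case: (posnP (s m.+1)) (posnP (t m.+1)) => sm [] tm.
- by apply: (IH n) => //; apply: low.
- by have := zeckendorf_lt zs (low _ bs sm); have := big _ zt tm; lia.
- by have := zeckendorf_lt zt (low _ bt tm); have := big _ zs sm; lia.
rewrite -(@msetB1K _ m.+1 s) ?in_mset // -(@msetB1K _ m.+1 t) ?in_mset //.
congr (_ +` _); apply: (IH (n - F m.+1)).
- exact: bounded_rem.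
- exact: bounded_rem.
- exact: is_zeckendorf_rem.
- exact: is_zeckendorf_rem.
Qed.

(* The starting state exists and is unique by zeckendorf_exists and
   zeckendorf_unique, so the quantifier below is neither vacuous nor
   ambiguous. *)
Definition player1_wins (n : nat) : Prop :=
  forall s, is_zeckendorf n s -> forced_win s.

(* Main.v *)
Require Import Defs.
From mathcomp Require Import all_boot.
From mathcomp Require Import finmap multiset zify.

(** Player 1 opens by combining the two chips into two chips [F_i].  From then
    on Player 2 always faces a state all of whose heights are even; every move
    removes at most one chip per bin, so Player 1 can repeat it, which makes all
    heights even again.  The game is finite because giving weight [3 ^ k] to a
    chip of bin [k] makes every move decrease the total weight. *)

Set Implicit Arguments.
Unset Strict Implicit.
Unset Printing Implicit Defensive.

Local Open Scope nat_scope.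
Local Open Scope mset_scope.

Definition heightE := (@msetE2 nat, @msetnE nat).

Lemma height_exchange (s A B : state) k :
  ((s `\` A) `+` B) k = s k - A k + B k.
Proof. by rewrite !heightE. Qed.

(** Separating the chips removed from the chips added lets the same exchange be replayed from
    another state. *)
Inductive exchange : state -> state -> Prop :=
| ExSplit k of 3 <= k : exchange [mset k] [mset k - 1; k - 2]
| ExSplit2 : exchange [mset 2] [mset 1; 1]
| ExCombine k of 2 < k : exchange [mset k - 2; k + 1] [mset k; k]
| ExCombine2 : exchange [mset 1; 3] [mset 2; 2].

Lemma moveE (s t : state) : move s t <->
  exists A B, [/\ exchange A B, forall k, A k <= s k & t = (s `\` A) `+` B].
Proof.
split.
  case=> [k k3 sk|s2|k k2 sk sk'|s1 s3].
  - exists [mset k], [mset k - 1; k - 2]; split=> // [|j]; first exact: ExSplit.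
    by rewrite !heightE; case: eqP => [->|].
  - exists [mset 2], [mset 1; 1]; split=> // [|j]; first exact: ExSplit2.
    by rewrite !heightE; case: eqP => [->|].
  - exists [mset k - 2; k + 1], [mset k; k].
    split=> // [|j]; first exact: ExCombine.
    by rewrite !heightE; case: eqP => [->|_]; [case: eqP; lia|case: eqP => // ->].
  - exists [mset 1; 3], [mset 2; 2]; split=> // [|j]; first exact: ExCombine2.
    by rewrite !heightE; case: eqP => [->|_] //; case: eqP => // ->.
case=> A [B [ex + ->]]; case: ex => [k k3||k k2|] As.
- by apply: Defs.Split => //; have := As k; rewrite !heightE eqxx.
- by apply: Split2; have := As 2; rewrite !heightE.
- apply: Combine => //; [have := As (k - 2)|have := As (k + 1)];
    by rewrite !heightE eqxx; lia.
- by apply: Combine2; [have := As 1|have := As 3]; rewrite !heightE.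
Qed.

(** The two chips used by a combine lie in different bins. *)
Lemma exchange_le1 A B : exchange A B -> forall k, A k <= 1.
Proof. by case=> [k k3||k k2|] j; rewrite !heightE; do !case: eqP => //; lia. Qed.

Definition weight (s : state) : nat := \sum_(k <- s) 3 ^ k.

Lemma weightD (s t : state) : weight (s `+` t) = weight s + weight t.
Proof.
rewrite /weight -big_cat /=; apply: perm_big; apply/allP => x _ /=.
by rewrite count_cat !count_mem_mset msetE2.
Qed.

Lemma weight1 k : weight [mset k] = 3 ^ k.
Proof. by rewrite /weight big_msetn. Qed.

(** With [x = 3 ^ (k - 2)], a split is [3x + x < 9x] and a combine is [18x < x + 27x]. Base 2 would
    fail on [ExSplit2], where [2 + 2 = 4]. *)
Lemma exchange_weight A B : exchange A B -> weight B < weight A.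
Proof.
case=> [k k3||k k2|]; rewrite ?weightD ?weight1 //.
- rewrite -(subnK (ltnW k3)) addnK addn2 subn1 /= !expnS.
  have : 0 < 3 ^ (k - 2) by rewrite expn_gt0.
  by lia.
- rewrite -(subnK (ltnW k2)) addnK addn1 addn2 !expnS.
  have : 0 < 3 ^ (k - 2) by rewrite expn_gt0.
  by lia.
Qed.

Lemma move_weight s t : move s t -> weight t < weight s.
Proof.
case/moveE=> A [B [ex As ->]].
have {2}-> : s = (s `\` A) `+` A.
  by apply/msetP => k; rewrite !heightE subnK.
by rewrite !weightD ltn_add2l exchange_weight.
Qed.

Lemma even_heights_lost (s t : state) :
  (forall k, ~~ odd (s k)) -> move s t -> forced_win t.
Proof.
have [m] := ubnP (weight s); elim: m => // m IH in s t *.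
move=> sm ev st; have [A [B [ex As tE]]] := (moveE s t).1 st.
(* A bin that loses a chip has positive even height, hence at least two chips: enough for the move
   and its copy. *)
have AAs k : A k + A k <= s k.
  by have := exchange_le1 ex k; have := As k; have := ev k; lia.
have tu : move t ((t `\` A) `+` B).
  apply/moveE; exists A, B; split=> // k.
  by rewrite tE height_exchange; have := AAs k; lia.
apply: (ForcedWin tu) => v; apply: IH.
  by have := move_weight st; have := move_weight tu; lia.
(* After both moves the height is [s k - 2 * A k + 2 * B k], again even. *)
by move=> k; rewrite tE !height_exchange; have := AAs k; have := ev k; lia.
Qed.

Theorem theorem1p1 (i n : nat) (hi : 3 <= i) (hn : n = F (i + 1) + F (i - 2)) :
  player1_wins n.
Proof.
move=> s zs.
(* The indices differ by 3, and [hi] keeps [i - 2] out of bin 0. *)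
have z : is_zeckendorf n [mset i - 2; i + 1].
  split=> [|k|k|].
  - by rewrite !heightE; do !case: eqP; lia.
  - by rewrite !heightE; do !case: eqP; lia.
  - by rewrite !heightE; do !case: eqP; lia.
  - by rewrite hn valueD1 /value big_msetn addnC.
rewrite (zeckendorf_unique zs z).
have open := @Combine [mset i - 2; i + 1] i hi.
apply: (ForcedWin (open _ _)); rewrite ?heightE ?eqxx; try lia.
(* The opening leaves height 2 in bin [i] and 0 elsewhere. *)
move=> t; apply: even_heights_lost => k.
by rewrite !heightE; lia.
Qed.
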